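(* Let $X$ be a metric space of bounded geometry with $\operatorname{asdim}(X)\le n$. Then $X$ admits a large scale uniform embedding into a product of $n+1$ locally finite trees.
   Context: The asymptotic dimension $\operatorname{asdim}X$ of a metric space $X$ is the minimal number $n$ (if it exists) such that for every $d>0$ there is a uniformly bounded cover $\mathcal{U}$ of $X$ which is a union of $n+1$ $d$-disjoint families $\mathcal{U}=\mathcal{U}^0\cup\dots\cup\mathcal{U}^n$. A family $\mathcal{V}$ of sets is $d$-disjoint if $d(V,V')=\inf\{d(x,x')\mid x\in V,\ x'\in V'\}>d$ for all distinct $V,V'\in\mathcal{V}$. A metric space $X$ has bounded geometry if for every $\epsilon>0$ and every $r>0$ there is $c$ such that every ball $B_r(x)$ contains no more than $c$ pairwise $\epsilon$-separated points. A map (not necessarily continuous) $f:X\to Y$ between metric spaces is a large scale uniform embedding if there are functions $\rho_1,\rho_2:[0,\infty)\to[0,\infty)$ tending to infinity such that $\rho_1(d_X(x,x'))\le d_Y(f(x),f(x'))\le\rho_2(d_X(x,x'))$ for all $x,x'\in X$. Trees carry the geodesic metric with edges of length one; a tree is locally finite if every vertex has finite degree. The product of trees carries the $\ell_1$ product metric. *)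

(* Defs.v *)
From HB Require Import structures.
From mathcomp Require Import all_boot all_order all_algebra.
From mathcomp Require Import all_classical all_reals all_analysis.

Set Implicit Arguments.
Unset Strict Implicit.
Unset Printing Implicit Defensive.

Import Order.TTheory GRing.Theory Num.Theory.
Import numFieldNormedType.Exports.

Local Open Scope classical_set_scope.
Local Open Scope ring_scope.

Section AsymptoticDimension.
Context {R : realType}.
Implicit Types X Y : metricType R.

(* The infimum is taken in the extended reals, where it is +oo as soon as one
   of the two sets is empty. *)
Definition set_dist X (V W : set X) : \bar R :=
  ereal_inf [set z | exists x y, [/\ V x, W y & z = (mdist x y)%:E]].

Definition disjoint_family X (d : R) (F : set (set X)) : Prop :=
  forall V W, F V -> F W -> V <> W -> (d%:E < set_dist V W)%E.

Definition uniformly_bounded X (F : set (set X)) : Prop :=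
  exists B : R, forall V, F V -> forall x y, V x -> V y -> mdist x y <= B.

Definition is_cover X (F : set (set X)) : Prop :=
  \bigcup_(V in F) V = setT.

Definition has_disjoint_covers X (n : nat) : Prop :=
  forall d : R, 0 < d ->
    exists U : 'I_n.+1 -> set (set X),
      [/\ is_cover (\bigcup_i U i), uniformly_bounded (\bigcup_i U i)
        & forall i, disjoint_family d (U i)].

Definition is_asdim X (n : nat) : Prop :=
  has_disjoint_covers X n /\ forall m, (m < n)%N -> ~ has_disjoint_covers X m.

(* In particular, the asymptotic dimension of X exists. *)
Definition asdim_le X (n : nat) : Prop :=
  exists2 m, (m <= n)%N & is_asdim X m.

Definition separated X (eps : R) (A : set X) : Prop :=
  forall x y, A x -> A y -> x <> y -> eps <= mdist x y.

Definition bounded_geometry X : Prop :=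
  forall eps r : R, 0 < eps -> 0 < r ->
    exists c : nat, forall (x : X) (A : set X),
      A `<=` ball x r -> separated eps A -> (A #<= `I_c)%card.

(* Only the values of rho1 and rho2 on [0, +oo[ matter. *)
Definition large_scale_uniform_embedding X Y (f : X -> Y) : Prop :=
  exists rho1 rho2 : R -> R,
    [/\ forall t, 0 <= t -> 0 <= rho1 t /\ 0 <= rho2 t,
        rho1 t @[t --> +oo] --> +oo,
        rho2 t @[t --> +oo] --> +oo
      & forall x x', rho1 (mdist x x') <= mdist (f x) (f x')
                       <= rho2 (mdist x x')].

End AsymptoticDimension.

(* A simple cycle of an undirected graph has at least three vertices: for
   adjacent x and y, the sequence [:: x; y] satisfies ucycle. *)
Record tree : Type := Tree {
  vertex :> choiceType;
  adj : rel vertex;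
  adj_sym : symmetric adj;
  adj_irr : irreflexive adj;
  tree_inhabited : exists v : vertex, True;
  tree_connected : forall u v, exists2 p, path adj u p & last u p = v;
  tree_acyclic : forall c, ucycle adj c -> (size c <= 2)%N }.

Definition locally_finite (T : tree) : Prop :=
  forall v : T, finite_set [set w | adj v w].

Section Realization.
Variables (R : realType) (T : tree).

(* Barycentric coordinates of the point at parameter t of the segment from u
   to v; for u = v this is the vertex u. *)
Definition bary (u v : T) (t : R) : T -> R :=
  fun w => (1 - t) * (w == u)%:R + t * (w == v)%:R.

(* The points of the tree, interior points of edges included. The degenerate
   case u = v is needed for the tree reduced to a single vertex. *)
Record realization : Type := Point {
  coord :> T -> R;
  coordP : exists u v t,
    [/\ (u == v) || adj u v, 0 <= t <= 1 & coord = bary u v t] }.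

(* [polyline p q l]: some piecewise linear path from p to q, each piece of
   which lies in a single edge, has length l. *)
Inductive polyline : realization -> realization -> R -> Prop :=
| polyline_nil p : polyline p p 0
| polyline_cons u v s t (p q r : realization) l :
    adj u v -> 0 <= s <= 1 -> 0 <= t <= 1 ->
    coord p = bary u v s -> coord q = bary u v t ->
    polyline q r l -> polyline p r (`|s - t| + l).

Definition geodesic_dist (p q : realization) : R :=
  inf [set l | polyline p q l].

Lemma polyline_ge0 p q l : polyline p q l -> 0 <= l.
Proof. by elim=> // *; rewrite addr_ge0. Qed.

Lemma polyline_cat p q r l m :
  polyline p q l -> polyline q r m -> polyline p r (l + m).
Proof.
move=> pq; elim: pq m => [x|u v s t x y z k uv hs ht xE yE _ IH] m.
  by rewrite add0r.
by move=> /IH yr; rewrite -addrA; exact: (polyline_cons uv hs ht xE yE yr).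
Qed.

Lemma polyline_edge u v s t (p q : realization) :
  adj u v -> 0 <= s <= 1 -> 0 <= t <= 1 ->
  coord p = bary u v s -> coord q = bary u v t -> polyline p q `|s - t|.
Proof.
move=> uv hs ht pE qE; rewrite -[`|_|]addr0.
exact: (polyline_cons uv hs ht pE qE (polyline_nil q)).
Qed.

Lemma polyline_sym p q l : polyline p q l -> polyline q p l.
Proof.
elim=> [x|u v s t x y z k uv hs ht xE yE _ IH]; first exact: polyline_nil.
rewrite addrC distrC; apply: (polyline_cat IH).
exact: (polyline_edge uv ht hs yE xE).
Qed.

Lemma realization_eq (p q : realization) : coord p = coord q -> p = q.
Proof.
case: p q => [p pP] [q qP] /= pq; case: q / pq qP => qP.
by congr Point; exact: Prop_irrelevance.
Qed.

Fact vertex_point_subproof (u : T) : exists u' v t,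
  [/\ (u' == v) || adj u' v, 0 <= t <= 1 & bary u u 0 = bary u' v t].
Proof. by exists u, u, 0; rewrite eqxx lexx ler01. Qed.

Definition vertex_point u : realization := Point (vertex_point_subproof u).

Lemma bary0 u v : bary u v 0 = bary u u 0.
Proof. by apply/funext => w; rewrite /bary !mul0r. Qed.

Lemma bary1 u v : bary u v 1 = bary v v 0.
Proof. by apply/funext => w; rewrite /bary subrr subr0 !mul0r add0r addr0. Qed.

Lemma baryxx u t : bary u u t = bary u u 0.
Proof. by apply/funext => w; rewrite /bary -!mulrDl !subrK. Qed.

Lemma polyline_vertex p : exists u l, polyline p (vertex_point u) l.
Proof.
have [u [v [t [/orP[/eqP <-|uv] t01 pE]]]] := coordP p.
  exists u, 0; rewrite (@realization_eq p (vertex_point u)).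
    exact: polyline_nil.
  by rewrite pE baryxx.
exists u, `|t - 0|; apply: (polyline_edge uv t01 _ pE).
  by rewrite lexx ler01.
by rewrite bary0.
Qed.

Lemma polyline_path u s : path (@adj T) u s ->
  polyline (vertex_point u) (vertex_point (last u s)) (size s)%:R.
Proof.
elim: s u => [u _|v s IH u /= /andP[uv /IH vs]]; first exact: polyline_nil.
rewrite -natr1 addrC.
have {1}-> : 1 = `|0 - 1| :> R by rewrite sub0r normrN normr1.
apply: (polyline_cons uv _ _ _ _ vs); rewrite ?lexx ?ler01 //=.
  by rewrite bary0.
by rewrite bary1.
Qed.

Lemma polyline_exists p q : exists l, polyline p q l.
Proof.
have [u [k pu]] := polyline_vertex p; have [v [l qv]] := polyline_vertex q.
have [s us sv] := tree_connected u v.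
have := polyline_path us; rewrite sv => uv.
by eexists; exact: (polyline_cat (polyline_cat pu uv) (polyline_sym qv)).
Qed.

Lemma bary_dist u v s t w : adj u v -> `|bary u v s w - bary u v t w| <= `|s - t|.
Proof.
move=> uv; have uNv : u != v by apply: contraTneq uv => ->; rewrite adj_irr.
rewrite /bary; have [->|wu] := eqVneq w u.
  by rewrite (negPf uNv) !mulr1 !mulr0 !addr0 opprB addrC addrA subrK distrC.
have [_|_] := eqVneq w v; rewrite !mulr0 !add0r ?mulr1 //.
by rewrite oppr0 normr0.
Qed.

Lemma polyline_coord p q l w : polyline p q l -> `|p w - q w| <= l.
Proof.
elim=> [x|u v s t x y z k uv _ _ xE yE _ IH]; first by rewrite subrr normr0.
rewrite (le_trans (ler_distD (y w) _ _))// lerD//.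
by rewrite xE yE bary_dist.
Qed.

Lemma polyline_has_inf p q : has_inf [set l | polyline p q l].
Proof.
split; first exact: polyline_exists.
by exists 0 => l /polyline_ge0.
Qed.

Lemma geodesic_dist_le p q l : polyline p q l -> geodesic_dist p q <= l.
Proof. by move=> pq; apply: ge_inf => //; case: (polyline_has_inf p q). Qed.

Lemma geodesic_dist_lb p q x :
  (forall l, polyline p q l -> x <= l) -> x <= geodesic_dist p q.
Proof. by move=> H; apply: lb_le_inf => //; exact: polyline_exists. Qed.

Lemma geodesic_dist_edge u v s t (p q : realization) :
  adj u v -> 0 <= s <= 1 -> 0 <= t <= 1 ->
  coord p = bary u v s -> coord q = bary u v t -> geodesic_dist p q = `|s - t|.
Proof.
move=> uv hs ht pE qE; apply/eqP; rewrite eq_le; apply/andP; split.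
  exact/geodesic_dist_le/(polyline_edge uv).
apply: geodesic_dist_lb => l /(polyline_coord v); rewrite pE qE /bary eqxx.
have /negPf-> : v != u by apply: contraTneq uv => ->; rewrite adj_irr.
by rewrite !mulr0 !add0r !mulr1.
Qed.

Lemma geodesic_distxx p : geodesic_dist p p = 0.
Proof.
apply/eqP; rewrite eq_le geodesic_dist_le/=; last exact: polyline_nil.
by apply: geodesic_dist_lb => l /polyline_ge0.
Qed.

Lemma geodesic_dist_eq0 p q : geodesic_dist p q = 0 -> p = q.
Proof.
move=> pq0; apply/realization_eq/funext => w.
apply/eqP; rewrite -subr_eq0 -normr_le0 -pq0.
by apply: geodesic_dist_lb => l; exact: polyline_coord.
Qed.

Lemma geodesic_dist_sym p q : geodesic_dist p q = geodesic_dist q p.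
Proof.
by rewrite /geodesic_dist; congr inf; apply/seteqP; split=> l /polyline_sym.
Qed.

Lemma geodesic_dist_triangle q p r :
  geodesic_dist p r <= geodesic_dist p q + geodesic_dist q r.
Proof.
rewrite -lerBlDl; apply: geodesic_dist_lb => m qr.
rewrite lerBlDl -lerBlDr; apply: geodesic_dist_lb => l pq.
by rewrite lerBlDr; exact: geodesic_dist_le (polyline_cat pq qr).
Qed.

HB.instance Definition _ := gen_eqMixin realization.
HB.instance Definition _ := gen_choiceMixin realization.
HB.instance Definition _ := @isMetric.Build R realization geodesic_dist
  geodesic_distxx geodesic_dist_eq0 geodesic_dist_sym geodesic_dist_triangle.

Lemma mdist_realizationE p q : mdist p q = geodesic_dist p q.
Proof. by []. Qed.

End Realization.

Section L1Product.
Context {R : realType} {I : finType}.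

Definition l1_product (Y : I -> metricType R) : Type := forall i, Y i.

Variable Y : I -> metricType R.
Implicit Types x y z : l1_product Y.

Definition l1_dist x y : R := \sum_i mdist (x i) (y i).

Lemma l1_distxx x : l1_dist x x = 0.
Proof. by rewrite /l1_dist big1// => i _; rewrite mdistxx. Qed.

Lemma l1_dist_eq0 x y : l1_dist x y = 0 -> x = y.
Proof.
move/eqP; rewrite psumr_eq0 => [/allP xy|i _]; last exact: mdist_ge0.
apply: functional_extensionality_dep => i; apply: mdist_positivity.
by apply/eqP/xy; rewrite mem_index_enum.
Qed.

Lemma l1_dist_sym x y : l1_dist x y = l1_dist y x.
Proof. by apply: eq_bigr => i _; rewrite metric_sym. Qed.

Lemma l1_dist_triangle y x z : l1_dist x z <= l1_dist x y + l1_dist y z.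
Proof.
by rewrite -big_split/=; apply: ler_sum => i _; exact: metric_triangle.
Qed.

HB.instance Definition _ := gen_eqMixin (l1_product Y).
HB.instance Definition _ := gen_choiceMixin (l1_product Y).
HB.instance Definition _ := @isMetric.Build R (l1_product Y) l1_dist
  l1_distxx l1_dist_eq0 l1_dist_sym l1_dist_triangle.

Lemma mdist_l1_productE (x y : l1_product Y) :
  mdist x y = \sum_i mdist (x i) (y i).
Proof. by []. Qed.

End L1Product.

(* Main.v *)
Require Import Defs.
From mathcomp Require Import all_boot all_order all_algebra.
From mathcomp Require Import all_classical all_reals all_analysis.
From mathcomp Require Import ring lra.

(* For a fixed colour, families F_0, F_1, ... of subsets of X are built such
   that F_k is uniformly bounded and 3 d_k-disjoint with d_k -> oo, F_k has a
   member containing the k-ball about a base point x0, and the families are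
   nested with collars: if j < k, V in F_j comes d_j-close to W in F_k, then
   the d_j-neighbourhood of V lies in W. Over all colours, the k-th families
   still cover X. They are obtained from arbitrary d-disjoint covers with d
   large, by adding to each member the collars of the smaller sets close to it,
   in decreasing order of scale.

   The members of the families of one colour are the vertices of a tree, in
   which the parent of V is the first larger member containing V; a point is
   mapped to the first member containing it. If d(x, y) <= d_k, then at most one
   member of index at least k separates x and y, so their images have distance
   at most 2 k + 1. Conversely, the members separating x and y contribute to the
   distance of their images, and if d(x, y) exceeds the mesh of F_j then the
   member of F_j containing x, for some colour, separates x from y. *)

Set Implicit Arguments.
Unset Strict Implicit.
Unset Printing Implicit Defensive.

Import Order.TTheory GRing.Theory Num.Theory.

Local Open Scope classical_set_scope.
Local Open Scope ring_scope.

(* A family of disjoint sets is encoded by the partial equivalence relation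
   "x and y lie in a common member". *)
Record spread_per (R : realType) (X : metricType R) (D b : R)
    (r : X -> X -> Prop) : Prop := SpreadPer {
  spread_sym : forall x y, r x y -> r y x;
  spread_trans : forall y x z, r x y -> r y z -> r x z;
  spread_bound : forall x y, r x y -> mdist x y <= b;
  spread_near : forall x y, r x x -> r y y -> mdist x y <= D -> r x y }.

(** * Separated coloured families from asymptotic dimension *)

Section SpreadPer.
Context {R : realType} {X : metricType R}.
Implicit Types (x y z : X) (r : X -> X -> Prop) (D b : R).

Lemma spreadl D b r x y : spread_per D b r -> r x y -> r x x.
Proof. by move=> s xy; apply: (spread_trans s xy); apply: (spread_sym s). Qed.

Lemma spreadr D b r x y : spread_per D b r -> r x y -> r y y.
Proof. by move=> s /(spread_sym s) /(spreadl s). Qed.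

Lemma spread_covers n D : asdim_le X n -> 0 < D ->
  exists b (r : 'I_n.+1 -> X -> X -> Prop),
    (forall i, spread_per D b (r i)) /\ forall x, exists i, r i x x.
Proof.
case=> m mn [Xm _] D0; have [U [cU [b Ub] Ud]] := Xm D D0.
have UdE i V W x y : U i V -> U i W -> V x -> W y -> mdist x y <= D -> V = W.
  move=> UV UW Vx Wy xy; apply: contrapT => VW.
  have := Ud i _ _ UV UW VW; rewrite ltNge => /negP; apply.
  by apply: ereal_inf_le; exists (mdist x y)%:E => //; exists x, y.
(* The colours above [m] receive the empty family. *)
exists b, (fun i x y => (i < m.+1)%N /\ exists2 V, U (inord i) V & V x /\ V y).
split=> [i|x].
- split.
  + by move=> x y [im [V UV [Vx Vy]]]; split=> //; exists V.
  + move=> y x z [im [V UV [Vx Vy]]] [_ [W UW [Wy Wz]]]; split=> //.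
    exists V => //; split=> //.
    by rewrite (UdE _ _ _ y y UV UW) // mdistxx ltW.
  + by move=> x y [im [V UV [Vx Vy]]]; apply: (Ub V) => //; exists (inord i).
  + move=> x y [im [V UV [Vx _]]] [_ [W UW [Wy _]]] xy; split=> //.
    by exists V => //; split=> //; rewrite (UdE _ _ _ x y UV UW).
- have : setT x by []; rewrite -cU => -[V [i _ UV] Vx].
  exists (widen_ord (mn : (m.+1 <= n.+1)%N) i); split; first exact: (ltn_ord i).
  by exists V; rewrite //= inord_val.
Qed.

(* The ball and all the members close to it are merged into one member. *)
Lemma spread_add_ball D b r (x0 : X) rho : 0 <= D -> 0 <= b -> 0 <= rho ->
  spread_per D b r -> exists r', [/\ spread_per D ((rho + D + b) *+ 2) r',
    forall x, r x x -> r' x x &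
    forall x y, mdist x0 x <= rho -> mdist x0 y <= rho -> r' x y].
Proof.
move=> D0 b0 rho0 s.
pose core x := mdist x0 x <= rho \/
  exists u v, [/\ r x u, mdist x0 v <= rho & mdist u v <= D].
have core_bound x : core x -> mdist x0 x <= rho + D + b.
  case=> [xrho|[u [v [xu vrho uv]]]]; first by lra.
  have := spread_bound s xu; rewrite (metric_sym x).
  have := metric_triangle x0 v u; have := metric_triangle x0 u x.
  by rewrite (metric_sym v u); lra.
(* A point of a member that is [D]-close to the core lies in the core, so merging preserves the
   separation [D]. *)
have core_near x y : r x x -> mdist x y <= D -> core y -> core x.
  move=> xx xy [yrho|[u [v [yu vrho uv]]]]; right; first by exists x, y.
  exists u, v; split=> //; apply: (spread_trans s _ yu).
  by apply: (spread_near s) => //; exact: spreadl s yu.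
exists (fun x y => core x /\ core y \/ [/\ r x y, ~ core x & ~ core y]); split.
- split.
  + move=> x y [[? ?]|[xy ? ?]]; [by left|right; split=> //].
    exact: (spread_sym s).
  + move=> y x z [[? ?]|[xy ? ?]] [[? ?]|[yz ? ?]] //; first by left.
    by right; split=> //; apply: (spread_trans s xy).
  + move=> x y [[/core_bound cx /core_bound cy]|[/(spread_bound s) xy _ _]].
      have := metric_triangle x x0 y; rewrite (metric_sym x x0); lra.
    by apply: le_trans xy _; rewrite mulr2n; lra.
  + move=> x y xx yy xy.
    case: xx yy => [[cx _]|[xx ncx _]] [[cy _]|[yy ncy _]]; first by left.
    * by case: ncy; apply: (core_near y x) => //; rewrite metric_sym.
    * by case: ncx; apply: (core_near x y).
    * by right; split=> //; apply: (spread_near s).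
- move=> x xx; have [cx|ncx] := pselect (core x); first by left.
  by right.
- by move=> x y xrho yrho; left; split; left.
Qed.

Lemma spread_covers_ball n (x0 : X) D : asdim_le X n -> 0 < D ->
  exists b (r : 'I_n.+1 -> X -> X -> Prop),
   [/\ 0 <= b, forall i, spread_per D b (r i), forall x, exists i, r i x x &
     forall i x y, mdist x0 x <= D -> mdist x0 y <= D -> r i x y].
Proof.
move=> Xn D0; have [b [r [sr cr]]] := spread_covers Xn D0.
have sr' i : spread_per D `|b| (r i).
  case: (sr i) => s1 s2 s3 s4; split=> // x y xy.
  exact: le_trans (s3 _ _ xy) (ler_norm b).
have /choice[r' r'P] i :=
  spread_add_ball x0 (ltW D0) (normr_ge0 b) (ltW D0) (sr' i).
exists ((D + D + `|b|) *+ 2), r'; split.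
- by rewrite mulrn_wge0 // !addr_ge0 // ltW.
- by move=> i; case: (r'P i).
- by move=> x; have [i] := cr x; exists i; case: (r'P i) => _ + _; apply.
- by move=> i; case: (r'P i).
Qed.

End SpreadPer.

(** * Nesting the families of one colour by collars *)

Section Saturation.
Context {R : realType} {X : metricType R}.
Variables (r : nat -> X -> X -> Prop) (d e b : nat -> R).
Implicit Types (A : set X) (j k : nat).

(** The reach is twice the collar width: for [t = d j], a set within [d j] of the fully saturated
    set is within [d j + e j <= d j *+ 2] of the set grown at stage [j]. *)
Definition grow (t : R) (E : X -> X -> Prop) A : set X :=
  A `|` [set z | exists a v v',
           [/\ A a, mdist a v <= t *+ 2, E v v' & mdist v' z <= t]].

Definition image_per (s : set X -> set X) (r : X -> X -> Prop) x y : Prop :=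
  exists u, [/\ r u u, s (r u) x & s (r u) y].

(* Absorbing the sets of larger index first ensures that later additions, whose
   total thickness is at most [e j], cannot come [d j]-close to a set of index
   [j] that was not absorbed. *)
Fixpoint sat k : set X -> set X :=
  if k is j.+1 then fun A => sat j (grow (d j) (image_per (sat j) (r j)) A)
  else id.

Definition nest k := image_per (sat k) (r k).

(** Members thickened by [e k] still have gap [d k *+ 3]. In [eS], reach and width of a collar give
    [d k *+ 3], and [e k *+ 2 + b k] is the diameter of an absorbed member. *)
Hypothesis r_spread : forall k, spread_per (d k *+ 3 + e k *+ 2) (b k) (r k).
Hypothesis b_ge0 : forall k, 0 <= b k.
Hypothesis e0 : e 0%N = 0.
Hypothesis eS : forall k, e k.+1 = e k + d k *+ 3 + (e k *+ 2 + b k).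
Hypothesis e_le_d : forall k, e k <= d k.
Hypothesis e_ge0 : forall k, 0 <= e k.

Lemma sub_sat k A : A `<=` sat k A.
Proof. by elim: k A => [|k IH] A x Ax //; apply: IH; left. Qed.

(** The thickness bound is a premise because the induction proving it in [sat_near] uses this lemma
    at each stage. Saturated members that are [d k *+ 3]-close come from members that are
    [d k *+ 3 + e k *+ 2]-close, hence equal. *)
Lemma image_per_spread k :
  (forall A x, sat k A x -> exists2 a, A a & mdist a x <= e k) ->
  spread_per (d k *+ 3) (e k *+ 2 + b k) (nest k).
Proof.
move=> satP.
have rE u v x y : r k u u -> r k v v -> sat k (r k u) x -> sat k (r k v) y ->
    mdist x y <= d k *+ 3 -> r k u = r k v.
  move=> uu vv /satP[a ua ax] /satP[c vc cy] xy.
  have ac : r k a c.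
    apply: (spread_near (r_spread k)).
    - exact: spreadr (r_spread k) ua.
    - exact: spreadr (r_spread k) vc.
    - have := metric_triangle a x c; have := metric_triangle x y c.
      rewrite (metric_sym y c); lra.
  have uv : r k u v.
    apply: (spread_trans (r_spread k) ua).
    apply: (spread_trans (r_spread k) ac).
    exact: spread_sym (r_spread k) _ _ vc.
  apply/seteqP; split=> z.
    apply: (spread_trans (r_spread k)).
    exact: spread_sym (r_spread k) _ _ uv.
  exact: spread_trans (r_spread k) _ _ _ uv.
have dk0 : 0 <= d k *+ 3 by rewrite mulrn_wge0 // (le_trans _ (e_le_d k)).
split.
- by move=> x y [u [uu ux uy]]; exists u.
- move=> y x z [u [uu ux uy]] [v [vv vy vz]]; exists u; split=> //.
  by rewrite (rE _ _ _ _ uu vv uy vy) // mdistxx.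
- move=> x y [u [uu /satP[a ua ax] /satP[c uc cy]]].
  have : r k a c.
    apply: (spread_trans (r_spread k) _ uc).
    exact: spread_sym (r_spread k) _ _ ua.
  move=> /(spread_bound (r_spread k)).
  have := metric_triangle x a y; have := metric_triangle a c y.
  rewrite (metric_sym x a); lra.
- move=> x y [u [uu ux _]] [v [vv vy _]] xy; exists u; split=> //.
  by rewrite (rE _ _ _ _ uu vv ux vy).
Qed.

Lemma sat_near k A x : sat k A x -> exists2 a, A a & mdist a x <= e k.
Proof.
elim: k A x => [|k IH] A x /=.
  by move=> Ax; exists x; rewrite ?mdistxx ?e0.
move=> /IH[y [Ay yx|[a [v [v' [Aa av vv' v'y]]]] yx]].
  exists y => //; rewrite eS; have := b_ge0 k; have := e_ge0 k.
  have := e_le_d k; lra.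
exists a => //; have := spread_bound (image_per_spread IH) vv'.
rewrite eS.
have := metric_triangle a y x; have := metric_triangle a v' y.
have := metric_triangle a v v'; lra.
Qed.

Lemma nest_spread k : spread_per (d k *+ 3) (e k *+ 2 + b k) (nest k).
Proof. by apply: image_per_spread; exact: sat_near. Qed.

Lemma nest_sub k x y : r k x y -> nest k x y.
Proof.
move=> xy; exists x; have xx := spreadl (r_spread k) xy.
by split=> //; apply: sub_sat.
Qed.

(** The induction descends to the stage absorbing the members of index [j]. There [v] is within
    [d j *+ 2] of a point [a] of the grown set. If [a] lies in [A], the collar of the member of [v]
    gets added; if [a] lies in an added collar, the member inside that collar is within [d j *+ 3]
    of [v], so it is the member of [v]. *)
Lemma sat_collar j k A v w v' z : (j < k)%N -> nest j v v' -> sat k A w ->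
  mdist v w <= d j -> mdist v' z <= d j -> sat k A z.
Proof.
elim: k A => // k IH A.
rewrite ltnS leq_eqVlt => /orP[/eqP->|jk]; last exact: IH.
move=> vv' /(@sat_near k (grow (d k) (nest k) A))[a ga aw] vw v'z /=.
have va : mdist v a <= d k *+ 2.
  have := metric_triangle v w a; rewrite (metric_sym w a).
  have := e_le_d k; lra.
apply: sub_sat; right; case: ga => [Aa|[c [u [u' [Ac cu uu' u'a]]]]].
  by exists a, v, v'; split=> //; rewrite metric_sym.
exists c, u, v'; split=> //; apply: (spread_trans (nest_spread k) uu').
apply: (spread_trans (nest_spread k) _ vv').
apply: (spread_near (nest_spread k)).
- exact: spreadr (nest_spread k) uu'.
- exact: spreadl (nest_spread k) vv'.
- have := metric_triangle u' a v; rewrite (metric_sym a v); lra.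
Qed.

Lemma nest_collar j k x y x' z : (j < k)%N -> nest j x x' -> nest k y y ->
  mdist x y <= d j -> mdist x' z <= d j -> nest k z y.
Proof.
move=> jk xx' [u [uu uy _]] xy x'z; exists u; split=> //.
exact: sat_collar jk xx' uy xy x'z.
Qed.

End Saturation.

(** * Walks in a graph *)

Section Walk.
Context {V : choiceType} (a : rel V).

(** Lengths are only bounded above, since raising the index by one may leave the vertex of a point
    unchanged. *)
Definition walk (u v : V) (m : nat) : Prop :=
  exists p, [/\ path a u p, last u p = v & (size p <= m)%N].

Lemma walkxx u m : walk u u m.
Proof. by exists [::]. Qed.

Lemma walk1 u v : a u v -> walk u v 1.
Proof. by move=> uv; exists [:: v]; rewrite /= uv. Qed.

Lemma walk_cat v u w m m' : walk u v m -> walk v w m' -> walk u w (m + m').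
Proof.
move=> [p [up pv sp]] [q [vq qw sq]]; exists (p ++ q).
by rewrite cat_path last_cat size_cat up pv vq qw leq_add.
Qed.

Lemma walk_sym u v m : symmetric a -> walk u v m -> walk v u m.
Proof.
move=> sa [p [up pv sp]]; exists (rev (belast u p)).
rewrite -pv rev_path size_rev size_belast; split=> //.
  by rewrite (eq_path (e' := a)).
by case: p {up pv sp} => [|x p] //=; rewrite rev_cons last_rcons.
Qed.
End Walk.

(** * Trees given by a parent function *)

Section ParentTree.
Variables (V : choiceType) (parent : V -> V) (level : V -> nat).

Definition parent_adj : rel V := fun u v => (parent u == v) || (parent v == u).

Lemma parent_adj_sym : symmetric parent_adj.
Proof. by move=> u v; rewrite /parent_adj orbC. Qed.

Hypothesis level_parent : forall v, (level v < level (parent v))%N.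

Lemma parent_adj_irr : irreflexive parent_adj.
Proof.
move=> v; apply/negP; rewrite /parent_adj orbb => /eqP vv.
by have := level_parent v; rewrite vv ltnn.
Qed.

(* In a cycle, both neighbours of a vertex of minimal level are its parent. *)
Lemma parent_adj_acyclic c : ucycle parent_adj c -> (size c <= 2)%N.
Proof.
have [->//|c0] := eqVneq c [::].
have hasn : exists n, has (fun x => level x == n) c.
  case: c c0 => // x c _; exists (level x); by rewrite /= eqxx.
case: (ex_minnP hasn) => n /hasP[x xc /eqP xn] xmin ucc.
have upE y : y \in c -> parent_adj x y -> y = parent x.
  move=> yc /orP[/eqP->//|/eqP yx].
  have := level_parent y; rewrite yx xn ltnNge.
  by rewrite xmin //; apply/hasP; exists y.
have [i s cE] := rot_to xc; move: ucc; rewrite -(size_rot i) -(rot_ucycle i) cE.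
have sc y : y \in s -> y \in c.
  by move=> ys; rewrite -(mem_rot i) cE inE ys orbT.
case: s {cE} sc => [//|y s]; case/lastP: s => [//|s z] sc /andP[/=].
rewrite rcons_path last_rcons => /andP[xy /andP[_ zx]] /and3P[_ + _].
have zc : z \in c by apply: sc; rewrite inE mem_rcons inE eqxx orbT.
have yc : y \in c by apply: sc; rewrite inE eqxx.
have yz : y = z by rewrite (upE _ yc xy) (upE z zc) // parent_adj_sym.
by rewrite yz mem_rcons inE eqxx.
Qed.

Variable v0 : V.
Hypothesis connected : forall u v, exists m, walk parent_adj u v m.

Lemma parent_inhabited : exists v : V, True.
Proof. by exists v0. Qed.

Lemma parent_connected u v : exists2 p, path parent_adj u p & last u p = v.
Proof. by have [m [p [? ? _]]] := connected u v; exists p. Qed.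

Definition parent_tree : tree := @Tree V parent_adj parent_adj_sym
  parent_adj_irr parent_inhabited parent_connected parent_adj_acyclic.

End ParentTree.

(** * Estimates for the geodesic distance between vertices *)

Section GeodesicBounds.
Context {R : realType} {T : tree}.
Implicit Types (u v : T).

Lemma walk_geodesic_dist u v m : walk (@adj T) u v m ->
  geodesic_dist (vertex_point R u) (vertex_point R v) <= m%:R.
Proof.
move=> [p [up <- pm]].
apply: le_trans (geodesic_dist_le (polyline_path R up)) _.
by rewrite ler_nat.
Qed.

(** Summing over the support of [p], at most two vertices, keeps the sum finite in an infinite
    tree. *)
Definition affine_extension (h : T -> R) (p : realization R T) : R :=
  \sum_(w \in [set w | p w != 0]) p w * h w.

Lemma affine_extension_bary h (p : realization R T) u v t : u != v ->
  p = bary u v t :> (T -> R) -> affine_extension h p = (1 - t) * h u + t * h v.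
Proof.
move=> uv pE; rewrite /affine_extension pE.
rewrite (fsbig_widen _ [set u; v]) /=; first last.
- by move=> w [_ /negP]; rewrite negbK => /eqP w0 /=; rewrite w0 mul0r.
- move=> w /= w0; have [->|wu] := eqVneq w u; [by left|right].
  apply/eqP; apply: contraNT w0 => wv.
  by rewrite /bary (negPf wu) (negPf wv) !mulr0 addr0.
rewrite fsbigU //=; last by move=> w [/= -> /eqP]; rewrite (negPf uv).
rewrite !fsbig_set1 /bary !eqxx (negPf uv) eq_sym (negPf uv).
by rewrite !mulr0 !mulr1 addr0 add0r.
Qed.

(** Along any polyline the affine extension of [h] varies by at most the length, which bounds the
    infimum from below. *)
Lemma lipschitz_geodesic_dist (h : T -> R) u v :
  (forall x y, adj x y -> `|h x - h y| <= 1) ->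
  `|h u - h v| <= geodesic_dist (vertex_point R u) (vertex_point R v).
Proof.
move=> hL.
have H p q l : polyline p q l ->
    `|affine_extension h p - affine_extension h q| <= l.
  elim=> [x|x y s t p' q' r' l' xy _ _ pE qE _ IH].
    by rewrite subrr normr0.
  have xNy : x != y by apply: contraTneq xy => ->; rewrite adj_irr.
  apply: le_trans (ler_distD (affine_extension h q') _ _) _.
  rewrite lerD // (affine_extension_bary _ xNy pE).
  rewrite (affine_extension_bary _ xNy qE).
  have -> : (1 - s) * h x + s * h y - ((1 - t) * h x + t * h y) =
            (s - t) * (h y - h x) by ring.
  by rewrite normrM ler_piMr // distrC hL.
have Hv x : affine_extension h (vertex_point R x) = h x.
  rewrite /affine_extension /= (_ : [set w | _] = [set x]).
    by rewrite fsbig_set1 /bary eqxx !mulr1 subrK mul1r.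
  apply/seteqP; split=> w /=; rewrite /bary.
    have [->//|] := eqVneq w x; by rewrite !mulr0 addr0 eqxx.
  by move=> ->; rewrite eqxx !mulr1 subrK oner_neq0.
rewrite -!Hv; apply: geodesic_dist_lb => l; exact: H.
Qed.

End GeodesicBounds.

(** * The tree of a nested sequence of families *)

Section NestedTree.
Context {R : realType} {X : metricType R}.
Variables (x0 : X) (E : nat -> X -> X -> Prop) (d D : nat -> R).
Implicit Types (x y z : X) (j k l m : nat).

Hypothesis E_spread : forall k, spread_per (d k *+ 3) (D k) (E k).
Hypothesis E_collar : forall j k x y x' z, (j < k)%N -> E j x x' -> E k y y ->
  mdist x y <= d j -> mdist x' z <= d j -> E k z y.
Hypothesis E_ball : forall k x y,
  mdist x0 x <= k%:R -> mdist x0 y <= k%:R -> E k x y.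
Hypothesis d_ge1 : forall k, 1 <= d k.
Hypothesis d_homo : forall j k, (j <= k)%N -> d j <= d k.

Let E_sym k x y (xy : E k x y) : E k y x := spread_sym (E_spread k) xy.

Let E_trans k y x z (xy : E k x y) (yz : E k y z) : E k x z :=
  spread_trans (E_spread k) xy yz.

Let E_l k x y (xy : E k x y) : E k x x := spreadl (E_spread k) xy.

Let E_r k x y (xy : E k x y) : E k y y := spreadr (E_spread k) xy.

Lemma d_ge0 k : 0 <= d k.
Proof. exact: le_trans (d_ge1 k). Qed.

Lemma E_near k x y : E k x x -> E k y y -> mdist x y <= d k -> E k x y.
Proof.
move=> xx yy xy; apply: (spread_near (E_spread k)) => //.
by have := d_ge0 k; lra.
Qed.

(** The collar condition at a common point: a member meeting a member of larger index lies in it. *)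
Lemma E_absorb j k x y : (j < k)%N -> E j x y -> E k x x -> E k x y.
Proof.
move=> jk xy xx; apply: E_sym.
by apply: (E_collar jk xy xx); rewrite mdistxx d_ge0.
Qed.

(** The balls about [x0] exhaust [X], and each lies in a member of the corresponding index. *)
Lemma exists_level l x : exists m, (l <= m)%N && `[< E m x x >].
Proof.
exists (maxn l (Num.truncn (mdist x0 x)).+1); rewrite leq_maxl /=.
apply/asboolP; suff : mdist x0 x <= (maxn l (Num.truncn (mdist x0 x)).+1)%:R.
  by move=> ?; apply: E_ball.
apply: (@le_trans _ _ (Num.truncn (mdist x0 x)).+1%:R).
  by rewrite ltW // truncnS_gt.
by rewrite ler_nat leq_maxr.
Qed.

Definition lev l x : nat := ex_minn (exists_level l x).

Lemma levE l x : E (lev l x) x x.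
Proof. by rewrite /lev; case: ex_minnP => m /andP[_ /asboolP]. Qed.

Lemma leq_lev l x : (l <= lev l x)%N.
Proof. by rewrite /lev; case: ex_minnP => m /andP[]. Qed.

Lemma lev_min l m x : (l <= m)%N -> E m x x -> (lev l x <= m)%N.
Proof.
move=> lm mx; rewrite /lev; case: ex_minnP => m' _; apply.
by rewrite lm; apply/asboolP.
Qed.

Lemma lev_id m x : E m x x -> lev m x = m.
Proof. by move=> mx; apply/eqP; rewrite eqn_leq leq_lev lev_min. Qed.

Lemma lev_succ l x : l != lev l x -> lev l.+1 x = lev l x.
Proof.
move=> ll; have {}ll : (l < lev l x)%N by rewrite ltn_neqAle ll leq_lev.
apply/eqP; rewrite eqn_leq; apply/andP; split; first exact: lev_min (levE _ _).
by apply: lev_min (levE _ _); exact: ltnW (leq_lev _ _).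
Qed.

(** By [E_absorb], two points of a member of index [j] lie in the same members of larger index. *)
Lemma lev_eq j l x y : (j < l)%N -> E j x y -> lev l x = lev l y.
Proof.
move=> jl xy; apply/eqP; rewrite eqn_leq; apply/andP; split.
  apply: lev_min; rewrite ?leq_lev //.
  apply: (E_r (x := y)); apply: (E_absorb _ _ (levE l y)).
    exact: leq_trans jl (leq_lev _ _).
  exact: E_sym xy.
apply: lev_min; rewrite ?leq_lev //.
apply: (E_r (x := x)); apply: (E_absorb _ xy (levE l x)).
exact: leq_trans jl (leq_lev _ _).
Qed.

(** A chosen point of the member, depending only on the member because equal sets have the same
    [xget]. *)
Definition rep k x : X := xget x0 (E k x).

Lemma repE k x : E k x x -> E k x (rep k x).
Proof. by move=> xx; apply: (@xgetPex _ x0 (E k x)); exists x. Qed.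

Lemma rep_eq k x y : E k x y -> rep k x = rep k y.
Proof.
move=> xy; rewrite /rep; congr xget; apply/seteqP; split=> z.
  by apply: E_trans; exact: E_sym xy.
exact: E_trans _ xy.
Qed.

(* The first member of a family of index at least [l] that contains [x]. *)
Definition node l x : nat * X := (lev l x, rep (lev l x) x).

(** A fixed point of [node] pairs an index with the chosen point of a member of that index. Members
    thus form a subtype, with its choice structure, instead of a quotient. *)
Definition nodes := {p : nat * X | node p.1 p.2 == p}.

Lemma node_eq l l' x y : lev l x = lev l' y -> E (lev l x) x y ->
  node l x = node l' y.
Proof. by rewrite /node => <- /rep_eq ->. Qed.

Lemma node_proof l x : node (node l x).1 (node l x).2 == node l x.
Proof.
apply/eqP; rewrite [in RHS]/node /=.
have xr := repE (levE l x).
have E1 : lev (lev l x) (rep (lev l x) x) = lev l x.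
  by apply: lev_id; exact: E_r xr.
by rewrite /node E1 -(rep_eq xr).
Qed.

Definition vnode l x : nodes := exist _ (node l x) (node_proof l x).

Lemma vnode_eq l l' x y : lev l x = lev l' y -> E (lev l x) x y ->
  vnode l x = vnode l' y.
Proof. by move=> ll' xy; apply: val_inj; exact: node_eq. Qed.

Lemma vnodeK (u : nodes) : vnode (val u).1 (val u).2 = u.
Proof. by apply: val_inj; apply/eqP; exact: (valP u). Qed.

Lemma lev_node (u : nodes) : lev (val u).1 (val u).2 = (val u).1.
Proof. by have := congr1 (fun w => (val w).1) (vnodeK u). Qed.

Lemma nodeE (u : nodes) : E (val u).1 (val u).2 (val u).2.
Proof. by rewrite -{1}lev_node; exact: levE. Qed.

Definition up (u : nodes) : nodes := vnode (val u).1.+1 (val u).2.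

Definition height (u : nodes) : nat := (val u).1.

Lemma height_inj (u w : nodes) : height u = height w ->
  E (height u) (val u).2 (val w).2 -> u = w.
Proof.
move=> uw uEw; rewrite -(vnodeK u) -(vnodeK w).
by apply: vnode_eq; rewrite !lev_node.
Qed.

Lemma height_up u : (height u < height (up u))%N.
Proof. exact: leq_lev. Qed.

(** The parent can be computed from any point of the member, not just the chosen one. *)
Lemma up_vnode l x : up (vnode l x) = vnode (lev l x).+1 x.
Proof.
have xr := E_sym (repE (levE l x)).
have ll : lev (lev l x).+1 (rep (lev l x) x) = lev (lev l x).+1 x.
  exact: lev_eq xr.
apply: vnode_eq => //=; rewrite ll; apply: E_sym.
apply: E_absorb (leq_lev _ _) _ (levE _ _).
exact: E_sym xr.
Qed.

Let adj := parent_adj up.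

(** If [x] lies in a member of index [l], the second node is the parent of the first; otherwise the
    two coincide. *)
Lemma walk_up l x : walk adj (vnode l x) (vnode l.+1 x) 1.
Proof.
have [ll|/eqP/eqP ll] := eqVneq l (lev l x).
  by apply: walk1; rewrite /adj /parent_adj up_vnode -ll eqxx.
rewrite (@vnode_eq l l.+1 x x) ?lev_succ //; [exact: walkxx|exact: levE].
Qed.

Lemma walk_ups l m x : walk adj (vnode l x) (vnode (l + m) x) m.
Proof.
elim: m => [|m IH]; first by rewrite addn0; exact: walkxx.
by rewrite -[in X in walk _ _ _ X]addn1 addnS; apply: walk_cat IH (walk_up _ _).
Qed.

(** At equal levels, separation makes the two members equal. Otherwise the lower one has a collar
    containing both points; every larger member meeting it contains that collar, so its parent is
    the other member. *)
Lemma walk_near k x y : mdist x y <= d k -> walk adj (vnode k x) (vnode k y) 1.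
Proof.
wlog lxy : x y / (lev k x <= lev k y)%N => [H xy|xy].
  have [le_xy|/ltnW le_yx] := leqP (lev k x) (lev k y); first exact: H.
  by apply: walk_sym; [exact: parent_adj_sym|apply: H; rewrite // metric_sym].
have dxy : mdist x y <= d (lev k x).
  exact: le_trans xy (d_homo (leq_lev _ _)).
move: lxy; rewrite leq_eqVlt => /orP[/eqP lxy|lxy].
  have -> : vnode k x = vnode k y.
    by apply: vnode_eq => //; apply: E_near dxy; [|rewrite lxy]; exact: levE.
  exact: walkxx.
apply: walk1; rewrite /adj /parent_adj up_vnode; apply/orP; left; apply/eqP.
have xy' : E (lev k y) x y.
  by apply: (E_collar lxy (levE k x) (levE k y)) => //; rewrite mdistxx d_ge0.
have yx : E (lev (lev k x).+1 x) y x.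
  apply: (E_collar (leq_lev _ _) (levE k x) (levE _ x)) => //.
  by rewrite mdistxx d_ge0.
have ll : lev (lev k x).+1 x = lev k y.
  apply/eqP; rewrite eqn_leq lev_min //; last exact: E_l xy'.
  apply: lev_min; last exact: E_l yx.
  by apply: leq_trans (leq_lev _ _); rewrite leqW // leq_lev.
by apply: vnode_eq; rewrite ll.
Qed.

Lemma walk_leaf k x y : mdist x y <= d k ->
  walk adj (vnode 0 x) (vnode 0 y) (k + 1 + k).
Proof.
move=> xy; apply: walk_cat (walk_cat (walk_ups 0 k x) (walk_near xy)) _.
apply: walk_sym (walk_ups 0 k y); exact: parent_adj_sym.
Qed.

Lemma nodes_connected u v : exists m, walk adj u v m.
Proof.
rewrite -(vnodeK u) -(vnodeK v).
move: (val u).1 (val u).2 (val v).1 (val v).2 => k x l y.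
(* At index [m], both points lie in the member containing the [m]-ball about [x0], where the two
   upward walks meet. *)
pose m := maxn (maxn k l)
  (maxn (Num.truncn (mdist x0 x)).+1 (Num.truncn (mdist x0 y)).+1).
have mE z : (Num.truncn (mdist x0 z) < m)%N -> mdist x0 z <= m%:R.
  move=> zm; apply: (@le_trans _ _ (Num.truncn (mdist x0 z)).+1%:R).
    by rewrite ltW // truncnS_gt.
  by rewrite ler_nat.
have xm : mdist x0 x <= m%:R by apply: mE; rewrite /m !leq_max leqnn !orbT.
have ym : mdist x0 y <= m%:R by apply: mE; rewrite /m !leq_max leqnn !orbT.
have km : (k <= m)%N by rewrite /m !leq_max leqnn.
have lm : (l <= m)%N by rewrite /m !leq_max leqnn orbT.
exists (m - k + (m - l))%N.
apply: (walk_cat (v := vnode m x)).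
  by have := walk_ups k (m - k) x; rewrite subnKC.
have -> : vnode m x = vnode m y.
  by apply: vnode_eq; rewrite lev_id ?lev_id //; apply: E_ball.
apply: walk_sym; first exact: parent_adj_sym.
by have := walk_ups l (m - l) y; rewrite subnKC.
Qed.

Definition nested_tree : tree :=
  parent_tree height_up (vnode 0 x0) nodes_connected.

(** The children of [v] have smaller index and chosen points in the member of [v], which is bounded.
    For a fixed index these points are 1-separated, so bounded geometry leaves finitely many. *)
Lemma nested_tree_locally_finite :
  bounded_geometry X -> locally_finite nested_tree.
Proof.
move=> bg v; pose k := height v; pose y := (val v).2.
pose C j := [set u : nodes | height u = j /\ E k (val u).2 y].
have C_fin j : finite_set (C j).
  have [c cP] := bg 1 (`|D k| + 1) ltr01 ltac:(by rewrite ltr_wpDl).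
  have inj : {in C j &, injective (fun u : nodes => (val u).2)}.
    move=> u w /set_mem[hu _] /set_mem[hw _] uw.
    rewrite -(vnodeK u) -(vnodeK w).
    by rewrite uw -/(height u) -/(height w) hu hw.
  rewrite -(eq_finite_set (inj_card_eq inj)).
  apply: card_le_finite (finite_II c); apply: (cP y).
    move=> _ [u [_ uy] <-]; rewrite ballEmdist /=.
    have := spread_bound (E_spread k) uy.
    rewrite metric_sym => /le_lt_trans; apply.
    by rewrite (le_lt_trans (ler_norm _)) // ltrDl.
  move=> _ _ [u [uj _] <-] [w [wj _] <-] uw; rewrite leNgt; apply/negP => uw1.
  apply: uw; congr (val _).2; apply: height_inj; rewrite ?uj ?wj //.
  apply: E_near; first by rewrite -uj; exact: nodeE.
    by rewrite -wj; exact: nodeE.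
  exact: le_trans (ltW uw1) (d_ge1 j).
apply: (@sub_finite_set nodes _ ([set up v] `|` \bigcup_(j in `I_k) C j)).
  move=> u /orP[/eqP <-|/eqP uv]; first by left.
  right; exists (height u) => /=; first by rewrite /k -uv; exact: height_up.
  by split=> //; rewrite /k /y -uv; exact: repE (levE _ _).
rewrite finite_setU; split; first exact: finite_set1.
by apply: bigcup_finite.
Qed.

Section Separation.
Variables (K : nat) (x' : X).

Definition sep_level x j : bool := `[< E j x x /\ ~ E j x x' >].

(** This is the Lipschitz function giving the lower bound: it counts the indices, from that of [u]
    up to [K], of members containing [u] but not [x']. *)
Definition sep_count (u : nodes) : R :=
  \sum_((val u).1 <= j < K) (sep_level (val u).2 j)%:R.

Lemma sep_count_vnode l x :
  sep_count (vnode l x) = \sum_(l <= j < K) (sep_level x j)%:R.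
Proof.
rewrite /sep_count /=; set m := lev l x; have xm := levE l x.
have -> : \sum_(m <= j < K) (sep_level (rep m x) j)%:R =
          \sum_(m <= j < K) (sep_level x j)%:R :> R.
  rewrite !big_nat; apply: eq_bigr => j /andP[mj _]; congr (nat_of_bool _)%:R.
  have xr : E j x x \/ E j (rep m x) (rep m x) -> E j x (rep m x).
    move: mj; rewrite leq_eqVlt => /orP[/eqP <-|mj].
      by move=> _; exact: repE.
    case=> [xx|rr]; first exact: E_absorb mj (repE xm) xx.
    by apply: E_sym; exact: E_absorb mj (E_sym (repE xm)) rr.
  apply: asbool_equiv_eq; split=> -[ww nw].
    have {}xr := xr (or_intror ww); split; first exact: E_l xr.
    by move=> xx'; apply: nw; exact: E_trans (E_sym xr) xx'.
  have {}xr := xr (or_introl ww); split; first exact: E_r xr.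
  by move=> rx'; apply: nw; exact: E_trans xr rx'.
(* No member of index from [l] up to, but excluding, [m] contains [x], so the sum may start at
   [l]. *)
have sep0 K' : (K' <= m)%N -> \sum_(l <= j < K') (sep_level x j)%:R = 0 :> R.
  move=> Km; rewrite big_nat big1 // => j /andP[lj jK].
  rewrite /sep_level asboolF // => -[xj _].
  by have := lev_min lj xj; rewrite leqNgt (leq_trans jK Km).
have [Km|/ltnW mK] := leqP K m; first by rewrite sep0 // big_geq.
by rewrite [RHS](big_cat_nat (leq_lev l x) mK) /= sep0 ?add0r.
Qed.

(** Passing to the parent drops at most the one term at the index of the child; the skipped indices
    contribute nothing. *)
Lemma sep_count_lipschitz u v : adj u v -> `|sep_count u - sep_count v| <= 1.
Proof.
have H w : `|sep_count w - sep_count (up w)| <= 1.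
  rewrite /up sep_count_vnode /sep_count; have [lK|Kl] := ltnP (val w).1 K.
    by rewrite big_ltn // addrK; case: sep_level; rewrite ?normr1 ?normr0.
  by rewrite !big_geq ?subrr ?normr0 // leqW.
by move=> /orP[/eqP <-|/eqP <-] //; rewrite distrC.
Qed.

End Separation.

Definition leaf_point x : realization R nested_tree :=
  @vertex_point R nested_tree (vnode 0 x).

Lemma leaf_point_le k x y : mdist x y <= d k ->
  mdist (leaf_point x) (leaf_point y) <= (k + 1 + k)%:R.
Proof.
move=> /walk_leaf; exact: (@walk_geodesic_dist R nested_tree).
Qed.

(** [sep_count K y] vanishes at the node of [y], and at the node of [x] it is the sum on the
    left. *)
Lemma leaf_point_ge K x y :
  \sum_(0 <= j < K) `[< E j x x /\ ~ E j x y >]%:R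
    <= mdist (leaf_point x) (leaf_point y).
Proof.
apply: le_trans (@lipschitz_geodesic_dist R nested_tree (sep_count K y)
  (vnode 0 x) (vnode 0 y) (@sep_count_lipschitz K y)).
rewrite !sep_count_vnode [X in _ - X]big1 => [|j _].
  by rewrite subr0 ler_norm.
by rewrite /sep_level asboolF // => -[].
Qed.

Lemma nested_families_tree : bounded_geometry X ->
  exists (T : tree) (f : X -> realization R T),
  [/\ locally_finite T,
      forall k x y, mdist x y <= d k -> mdist (f x) (f y) <= (k + 1 + k)%:R &
      forall K x y, \sum_(0 <= j < K) `[< E j x x /\ ~ E j x y >]%:R
                      <= mdist (f x) (f y)].
Proof.
move=> bg; exists nested_tree, leaf_point; split.
- exact: nested_tree_locally_finite.
- exact: leaf_point_le.
- exact: leaf_point_ge.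
Qed.

End NestedTree.

(** * Choice of the scales *)

Section Scales.
Context {R : realType}.
Variable b : R -> R.

(** [thickness], [margin] and [gap] are the [e], the [d] and the initial separation of the
    saturation. The summand [k.+1] in [margin] makes it at least 1 and unbounded. *)
Fixpoint thickness k : R :=
  if k is j.+1 then
    let e := thickness j in
    let d := e + j.+1%:R in
    e + d *+ 3 + (e *+ 2 + b (d *+ 3 + e *+ 2))
  else 0.

Definition margin k : R := thickness k + k.+1%:R.

Definition gap k : R := margin k *+ 3 + thickness k *+ 2.

Definition mesh k : R := thickness k *+ 2 + b (gap k).

Lemma thicknessS k : thickness k.+1 = thickness k + margin k *+ 3 + mesh k.
Proof. by []. Qed.

Hypothesis b_ge0 : forall D, 0 < D -> 0 <= b D.

Lemma thickness_ge0 k : 0 <= thickness k.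
Proof.
elim: k => //= k IH; have k0 : 0 < k.+1%:R :> R by rewrite ltr0n.
rewrite !addr_ge0 ?mulrn_wge0 ?addr_ge0 ?(ltW k0) //.
by apply: b_ge0; rewrite ltr_wpDr ?mulrn_wge0 // pmulrn_rgt0 // ltr_wpDl.
Qed.

Lemma gap_gt k : k%:R < gap k.
Proof.
rewrite /gap /margin -natr1; have := thickness_ge0 k; have := ler0n R k; lra.
Qed.

Lemma gap_gt0 k : 0 < gap k.
Proof. by rewrite (le_lt_trans _ (gap_gt k)). Qed.

Lemma mesh_ge0 k : 0 <= mesh k.
Proof. by rewrite addr_ge0 ?mulrn_wge0 ?thickness_ge0 ?b_ge0 ?gap_gt0. Qed.

Lemma margin_gt k : k%:R < margin k.
Proof. rewrite /margin -natr1; have := thickness_ge0 k; lra. Qed.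

Lemma margin_homo j k : (j <= k)%N -> margin j <= margin k.
Proof.
apply: (homo_leq (f := margin) (r := fun x y => x <= y)) => // [y x z|i].
  exact: le_trans.
rewrite {2}/margin thicknessS; have := mesh_ge0 i; have := thickness_ge0 i.
have := margin_gt i; rewrite -natr1 {2 3}/margin -natr1; have := ler0n R i; lra.
Qed.

End Scales.

(** * The one-vertex tree, used for empty [X] *)

Section UnitTree.
Let adj0 : rel unit := fun _ _ => false.

Lemma unit_connected u v : exists2 p, path adj0 u p & last u p = v.
Proof. by case: u v => -[]; exists [::]. Qed.

Lemma unit_acyclic c : ucycle adj0 c -> (size c <= 2)%N.
Proof. by case: c => [|? [|? ?]]. Qed.

Definition unit_tree : tree := @Tree unit adj0 (fun _ _ => erefl)
  (fun _ => erefl) (ex_intro _ tt I) unit_connected unit_acyclic.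

Lemma unit_tree_locally_finite : locally_finite unit_tree.
Proof.
by move=> v; rewrite (_ : [set w | _] = set0) //; apply/seteqP; split.
Qed.

End UnitTree.

(** * Assembling the embedding over all colours *)

Theorem theorem3 (R : realType) (X : metricType R) (n : nat) :
  bounded_geometry X -> asdim_le X n ->
  exists T : 'I_n.+1 -> tree,
    (forall i, locally_finite (T i)) /\
    exists f : X -> l1_product (fun i => realization R (T i)),
      large_scale_uniform_embedding f.
Proof.
move=> bg Xn.
have [[x0 _]|X0] := pselect (exists x : X, True); last first.
  exists (fun=> unit_tree); split=> [_|]; first exact: unit_tree_locally_finite.
  exists (fun _ _ => @vertex_point R unit_tree tt), id, id.
  by split=> // x; case: X0; exists x.
(* Bounds and families are chosen for all [D] at once, with a dummy value for [D <= 0]. The bound is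
   common to all colours, so all trees share the same scales. *)
have /choice[br brP] D : exists br : R * ('I_n.+1 -> X -> X -> Prop), 0 < D ->
    [/\ 0 <= br.1, forall i, spread_per D br.1 (br.2 i),
        forall x, exists i, br.2 i x x &
        forall i x y, mdist x0 x <= D -> mdist x0 y <= D -> br.2 i x y].
  have [D0|] := ltP 0 D; last by exists (0, fun _ _ _ => False).
  by have [b [r bP]] := spread_covers_ball x0 Xn D0; exists (b, r).
pose b D := (br D).1.
have b_ge0 D : 0 < D -> 0 <= b D by move=> /brP[].
pose r i k := (br (gap b k)).2 i.
pose E i := nest (r i) (margin b).
have g0 := gap_gt0 b_ge0.
have r_spread i k : spread_per (gap b k) (b (gap b k)) (r i k).
  by have [_ + _ _] := brP _ (g0 k); apply.
have e_ge0 := thickness_ge0 b_ge0.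
have e_le_d k : thickness b k <= margin b k by rewrite lerDl.
have bg_ge0 k : 0 <= b (gap b k) by exact: b_ge0.
have E_spread i k : spread_per (margin b k *+ 3) (mesh b k) (E i k).
  exact: (nest_spread (r_spread i) bg_ge0).
have T_ex i : exists Tf : {T : tree & X -> realization R T},
    [/\ locally_finite (projT1 Tf),
      forall k x y, mdist x y <= margin b k ->
        mdist (projT2 Tf x) (projT2 Tf y) <= (k + 1 + k)%:R &
      forall K x y, \sum_(0 <= j < K) `[< E i j x x /\ ~ E i j x y >]%:R
                      <= mdist (projT2 Tf x) (projT2 Tf y)].
  have [||||T [f fP]] := @nested_families_tree R X x0 (E i) (margin b) (mesh b)
    (E_spread i) _ _ _ _ bg.
  - exact: nest_collar (r_spread i) bg_ge0 _ _ _ _.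
  - move=> k x y xk yk; apply: (nest_sub (r_spread i)).
    have [_ _ _] := brP _ (g0 k); apply; exact: le_trans (ltW (gap_gt b_ge0 k)).
  - move=> k; rewrite /margin -natr1; have := e_ge0 k; have := ler0n R k; lra.
  - exact: margin_homo.
  - by exists (existT _ T f).
have {T_ex}[Tf TfP] := choice T_ex.
exists (fun i => projT1 (Tf i)); split; first by move=> i; case: (TfP i).
exists (fun x i => projT2 (Tf i) x).
(* Each index with mesh below [t] yields a separating member in some colour; the cutoff at [t] keeps
   the count finite. *)
exists (fun t => \sum_(0 <= j < Num.truncn t) `[< mesh b j < t >]%:R).
exists (fun t => n.+1%:R * (t *+ 2 + 1)); split.
- move=> t t0; split; first by apply: sumr_ge0 => j _; exact: ler0n.
  by rewrite mulr_ge0 // addr_ge0 // mulrn_wge0.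
- apply/cvgryPge => A; near=> t.
  pose M := (Num.truncn A).+1.
  (* Such a [t] exceeds both [M] and every mesh of index below [M], so at least [M] indices are
     counted. *)
  have tM : M%:R + \sum_(0 <= j < M) mesh b j < t.
    by near: t; apply: nbhs_pinfty_gt; exact: num_real.
  have mesh0 := mesh_ge0 b_ge0.
  have Mt : (M <= Num.truncn t)%N.
    have S0 : 0 <= \sum_(0 <= j < M) mesh b j by apply: sumr_ge0.
    have Mt : M%:R <= t by rewrite (le_trans _ (ltW tM)) // lerDl.
    by rewrite truncn_ge_nat // (le_trans _ Mt).
  apply: (@le_trans _ _ M%:R); first by rewrite ltW // truncnS_gt.
  rewrite (big_cat_nat (leq0n M) Mt) /= -[leLHS]addr0 lerD //; last first.
    by apply: sumr_ge0 => j _; exact: ler0n.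
  rewrite [leRHS](_ : _ = \sum_(0 <= j < M) 1).
    by rewrite sumr_const_nat subn0.
  rewrite !big_nat; apply: eq_bigr => j /andP[_ jM]; rewrite asboolT //.
  apply: le_lt_trans tM; rewrite big_mkord (bigD1 (Ordinal jM)) //=.
  by rewrite addrCA lerDl addr_ge0 // sumr_ge0.
- apply/cvgryPge => A; near=> t.
  have tA : `|A| < t by near: t; apply: nbhs_pinfty_gt; exact: num_real.
  have := ler_norm A; have := normr_ge0 A.
  have : 1 <= n.+1%:R :> R by rewrite ler1n.
  nra.
- move=> x y; rewrite mdist_l1_productE; apply/andP; split.
    apply: (@le_trans _ _ (\sum_(i < n.+1)
      \sum_(0 <= j < Num.truncn (mdist x y))
        `[< E i j x x /\ ~ E i j x y >]%:R)); last first.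
      by apply: ler_sum => i _; case: (TfP i) => _ _; apply.
    (* For each counted [j], some colour has a member of index [j] containing [x]; its diameter is
       less than [mdist x y], so it misses [y]. *)
    rewrite exchange_big; apply: ler_sum => j _.
    case: asboolP => [jxy|_]; last by apply: sumr_ge0 => i _; exact: ler0n.
    have [_ _ + _] := brP _ (g0 j) => /(_ x)[i xx].
    rewrite (bigD1 i) //= asboolT.
      by rewrite lerDl; apply: sumr_ge0 => ? _; exact: ler0n.
    split; first exact: nest_sub (r_spread i) _ _ _ xx.
    by move=> /(spread_bound (E_spread i j)); rewrite leNgt jxy.
  (* This [k] satisfies [mdist x y < k.+1 <= margin b k], so each tree contributes at most
     [k + 1 + k]. *)
  pose k := Num.truncn (mdist x y).
  have xy : mdist x y <= margin b k.
    by rewrite ltW // (lt_le_trans (truncnS_gt _)) // lerDr.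
  apply: (@le_trans _ _ (\sum_(i < n.+1) (k + 1 + k)%:R)).
    by apply: ler_sum => i _; case: (TfP i) => _ + _; apply.
  rewrite sumr_const card_ord -[X in X <= _]mulr_natl ler_pM2l ?ltr0n //.
  have : k%:R <= mdist x y by rewrite truncn_le mdist_ge0.
  rewrite !natrD; lra.
Unshelve. all: by end_near.
Qed.
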